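(* The function $\varrho$ defined in the context satisfies the following three properties. (1) For all $\sigma_W>0$ and $P_X>0$, $$\lim_{\bar\sigma_V\to0^+}\varrho(\sigma_W^2,P_X^2,\bar\sigma_V)=\frac12\log_2\left(1+\frac{P_X^2}{\sigma_W^2}\right).$$ (2) For all $\sigma_W>0$ and $P_X>0$, $\varrho\left(\sigma_W^2,P_X^2,\frac{P_X}{2}\right)=0$. (3) For all $\sigma_W>0$ and $\bar\sigma_V>0$, the ratio $$\frac{\varrho(\sigma_W^2,P_X^2,\bar\sigma_V)}{\log_2\left(\frac{P_X}{\sigma_W+\bar\sigma_V}\right)}$$ tends to $1$ as $P_X\to\infty$.
   Context: For $\sigma_W,P_X,\bar\sigma_V>0$ with $4\bar\sigma_V^2\le P_X^2$, $\varrho(\sigma_W^2,P_X^2,\bar\sigma_V)$ is the unique non-negative real solution $\varrho$ of $\sigma_W\sqrt{2^{2\varrho}-1}=P_X-\bar\sigma_V(1+2^{\varrho})$; if $4\bar\sigma_V^2>P_X^2$, it is defined to be $0$. *)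

(* Defs.v *)
From Stdlib Require Import Reals Lra Psatz ClassicalEpsilon.
From Coquelicot Require Import Coquelicot.
Local Open Scope R_scope.

Definition log2 (x : R) : R := ln x / ln 2.

Definition varrho_solution (sW PX sV r : R) : Prop :=
  0 <= r /\ sW * sqrt (Rpower 2 (2 * r) - 1) = PX - sV * (1 + Rpower 2 r).

(* The first two arguments are the squares sW^2 and PX^2, the third is sV
   itself.  [epsilon] picks the unique solution; see [varrho_solution_unique]
   and [varrho_spec].  Only positive arguments are meaningful. *)
Definition varrho (sW2 PX2 sV : R) : R :=
  if Rle_dec (4 * sV ^ 2) PX2
  then epsilon (inhabits 0) (varrho_solution (sqrt sW2) (sqrt PX2) sV)
  else 0.

Lemma varrho_solution_unique (sW PX sV : R) :
  0 < sW -> 0 < PX -> 0 < sV -> 4 * sV ^ 2 <= PX ^ 2 ->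
  exists! r : R, varrho_solution sW PX sV r.
Proof.
intros HW HP HV Hle.
assert (H2 : 2 * sV <= PX) by nra.
assert (Hln2 : 0 < ln 2) by (rewrite <- ln_1; apply ln_increasing; lra).
pose (f := fun r => sW * sqrt (Rpower 2 (2 * r) - 1) + sV * (1 + Rpower 2 r)).
assert (Hinc : forall x y, x < y -> f x < f y).
{ intros x y Hxy. unfold f.
  assert (Rpower 2 x < Rpower 2 y) by (apply Rpower_lt; lra).
  assert (Rpower 2 (2 * x) < Rpower 2 (2 * y)) by (apply Rpower_lt; lra).
  assert (sqrt (Rpower 2 (2 * x) - 1) <= sqrt (Rpower 2 (2 * y) - 1))
    by (apply sqrt_le_1_alt; lra).
  nra. }
assert (Hpow : forall x, continuous (fun r => Rpower 2 r) x).
{ intros x. apply (continuous_comp (fun r => r * ln 2) exp).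
  - apply (ex_derive_continuous (fun r => r * ln 2)). auto_derive. exact I.
  - apply continuous_exp. }
assert (Hcont : forall x, continuity_pt f x).
{ intros x. apply continuity_pt_filterlim.
  apply (continuous_plus (fun r => sW * sqrt (Rpower 2 (2 * r) - 1))
                         (fun r => sV * (1 + Rpower 2 r))).
  - apply (continuous_scal_r sW (fun r => sqrt (Rpower 2 (2 * r) - 1))).
    apply (continuous_comp (fun r => Rpower 2 (2 * r) - 1) sqrt).
    + apply (continuous_minus (fun r => Rpower 2 (2 * r)) (fun _ => 1)).
      * apply (continuous_comp (fun r => 2 * r) (fun r => Rpower 2 r)).
        -- apply (ex_derive_continuous (fun r => 2 * r)). auto_derive. exact I.
        -- apply Hpow.
      * apply continuous_const.
    + apply continuous_sqrt.
  - apply (continuous_scal_r sV (fun r => 1 + Rpower 2 r)).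
    apply (continuous_plus (fun _ => 1) (fun r => Rpower 2 r)).
    + apply continuous_const.
    + apply Hpow. }
pose (b := log2 (PX / sV)).
assert (Hq : 2 <= PX / sV).
{ apply Rmult_le_reg_r with sV; [lra|]. unfold Rdiv.
  rewrite Rmult_assoc, Rinv_l, Rmult_1_r; lra. }
assert (Hb : Rpower 2 b = PX / sV).
{ unfold Rpower, b, log2.
  replace (ln (PX / sV) / ln 2 * ln 2) with (ln (PX / sV)) by (field; lra).
  apply exp_ln; lra. }
assert (Hb0 : 0 <= b).
{ unfold b, log2. apply Rdiv_le_0_compat; [|lra].
  rewrite <- ln_1. apply ln_le; lra. }
assert (Hf0 : f 0 <= PX).
{ unfold f. rewrite Rmult_0_r, Rpower_O by lra.
  rewrite Rminus_diag, sqrt_0; lra. }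
assert (Hfb : PX <= f b).
{ unfold f. rewrite Hb.
  assert (0 <= sqrt (Rpower 2 (2 * b) - 1)) by apply sqrt_pos.
  replace (sV * (1 + PX / sV)) with (sV + PX) by (field; lra). nra. }
destruct (IVT_gen f 0 b PX) as [r [Hr Hfr]].
{ intros x; apply Hcont. }
{ rewrite Rmin_left, Rmax_right; lra. }
rewrite Rmin_left, Rmax_right in Hr by lra.
exists r; split.
- split; [lra|]. unfold f in Hfr; lra.
- intros s [Hs Hfs].
  assert (f s = PX) by (unfold f; lra).
  destruct (Rtotal_order r s) as [h|[h|h]]; auto; apply Hinc in h; lra.
Qed.

Lemma varrho_spec (sW PX sV : R) :
  0 < sW -> 0 < PX -> 0 < sV -> 4 * sV ^ 2 <= PX ^ 2 ->
  varrho_solution sW PX sV (varrho (sW ^ 2) (PX ^ 2) sV).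
Proof.
intros HW HP HV Hle. unfold varrho.
destruct (Rle_dec (4 * sV ^ 2) (PX ^ 2)) as [_|n]; [|contradiction].
rewrite !sqrt_pow2 by lra.
apply epsilon_spec.
destruct (varrho_solution_unique sW PX sV HW HP HV Hle) as [r [Hr _]].
now exists r.
Qed.

(* Main.v *)
Require Import Defs.
From Stdlib Require Import Reals.
From Coquelicot Require Import Coquelicot.
From Stdlib Require Import Lra Psatz.
Local Open Scope R_scope.

(** In terms of [u = 2 ^ rho], the defining equation reads
    [sW * sqrt (u^2 - 1) = PX - sV * (1 + u)].  As [sV] tends to [0], bounding
    the right-hand side by [PX] gives [u <= U := sqrt (1 + PX^2 / sW^2)], and
    feeding this back gives a lower bound for [u] that converges to [U].  As
    [PX] tends to infinity, [u - 1 <= sqrt (u^2 - 1) <= u] pins [u] to within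
    distance [1] of [x := PX / (sW + sV)], so [log2 u] differs from [log2 x] by
    at most [1]. *)

Lemma ln_2_pos : 0 < ln 2.
Proof. rewrite <- ln_1; apply ln_increasing; lra. Qed.

Lemma log2_le (x y : R) : 0 < x -> x <= y -> log2 x <= log2 y.
Proof.
intros Hx Hxy; unfold log2, Rdiv.
apply Rmult_le_compat_r; [|now apply ln_le].
apply Rlt_le, Rinv_0_lt_compat, ln_2_pos.
Qed.

Lemma log2_mult_2 (x : R) : 0 < x -> log2 (2 * x) = log2 x + 1.
Proof.
intros Hx; pose proof ln_2_pos; unfold log2.
rewrite ln_mult by lra; field; lra.
Qed.

Lemma log2_Rpower (r : R) : log2 (Rpower 2 r) = r.
Proof.
pose proof ln_2_pos; unfold log2, Rpower; rewrite ln_exp; field; lra.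
Qed.

Lemma log2_sqr (x : R) : 0 < x -> 1 / 2 * log2 (x ^ 2) = log2 x.
Proof.
intros Hx; pose proof ln_2_pos; unfold log2.
replace (x ^ 2) with (x * x) by ring.
rewrite ln_mult by lra; field; lra.
Qed.

Lemma continuous_log2 (x : R) : 0 < x -> continuous log2 x.
Proof.
intros Hx; pose proof ln_2_pos; apply (ex_derive_continuous log2); unfold log2.
auto_derive; lra.
Qed.

(** All later bounds on [varrho] go through this algebraic form, with [u] standing for
    [Rpower 2 r]. *)
Lemma varrho_log2 (sW PX sV : R) :
  0 < sW -> 0 < PX -> 0 < sV -> 2 * sV <= PX ->
  exists u : R, 1 <= u /\ varrho (sW ^ 2) (PX ^ 2) sV = log2 u /\
    sW * sqrt (u ^ 2 - 1) = PX - sV * (1 + u).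
Proof.
intros HW HP HV Hle.
destruct (varrho_spec sW PX sV HW HP HV) as [H0 Heq]; [nra|].
set (r := varrho (sW ^ 2) (PX ^ 2) sV) in *.
exists (Rpower 2 r); split; [|split].
- rewrite <- (Rpower_O 2) by lra; apply Rle_Rpower; lra.
- now rewrite log2_Rpower.
- rewrite <- Heq; do 3 f_equal.
  simpl; rewrite Rmult_1_r, <- Rpower_plus; f_equal; ring.
Qed.

(** Squaring gives a fixed-point form: while [PX - sV * (1 + u)] stays nonnegative, an upper bound
    for [u] on the right yields a lower bound on the left. *)
Lemma varrho_sqr_eq (sW PX sV u : R) :
  0 < sW -> 1 <= u -> sW * sqrt (u ^ 2 - 1) = PX - sV * (1 + u) ->
  u ^ 2 = 1 + (PX - sV * (1 + u)) ^ 2 / sW ^ 2.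
Proof.
intros HW Hu Heq; rewrite <- Heq, Rpow_mult_distr, pow2_sqrt by nra.
field; lra.
Qed.

Lemma varrho_le (sW PX sV : R) :
  0 < sW -> 0 < PX -> 0 < sV -> 2 * sV <= PX ->
  varrho (sW ^ 2) (PX ^ 2) sV <= 1 / 2 * log2 (1 + PX ^ 2 / sW ^ 2).
Proof.
intros HW HP HV Hle.
destruct (varrho_log2 sW PX sV HW HP HV Hle) as [u [Hu [-> Heq]]].
(* The root is nonnegative, so [PX - sV * (1 + u)] lies in [[0, PX]] and its square is at most
   [PX ^ 2]. *)
pose proof (sqrt_pos (u ^ 2 - 1)).
rewrite <- log2_sqr by lra.
apply Rmult_le_compat_l; [lra|]; apply log2_le; [nra|].
rewrite (varrho_sqr_eq _ _ _ _ HW Hu Heq).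
apply Rplus_le_compat_l, Rmult_le_compat_r.
- apply Rlt_le, Rinv_0_lt_compat; nra.
- apply pow_incr; nra.
Qed.

(** Since [u <= U], replacing [u] by [U] on the right of [varrho_sqr_eq] lowers the base of the
    square; the last hypothesis keeps that base nonnegative. *)
Lemma varrho_ge (sW PX sV : R) :
  let U := sqrt (1 + PX ^ 2 / sW ^ 2) in
  0 < sW -> 0 < PX -> 0 < sV -> sV * (1 + U) <= PX ->
  1 / 2 * log2 (1 + (PX - sV * (1 + U)) ^ 2 / sW ^ 2)
    <= varrho (sW ^ 2) (PX ^ 2) sV.
Proof.
intros U HW HP HV Hle.
assert (Hinv : 0 < / sW ^ 2) by (apply Rinv_0_lt_compat; nra).
assert (HU : 1 <= U).
{ unfold U; rewrite <- sqrt_1 at 1; apply sqrt_le_1_alt; unfold Rdiv; nra. }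
destruct (varrho_log2 sW PX sV HW HP HV) as [u [Hu [-> Heq]]]; [nra|].
pose proof (sqrt_pos (u ^ 2 - 1)) as Hs.
pose proof (varrho_sqr_eq _ _ _ _ HW Hu Heq) as Hsq.
assert (HuU : u <= U).
{ rewrite <- (sqrt_pow2 u) by lra; apply sqrt_le_1_alt; rewrite Hsq.
  apply Rplus_le_compat_l, Rmult_le_compat_r; [lra|].
  apply pow_incr; nra. }
rewrite <- (log2_sqr u) by lra.
apply Rmult_le_compat_l; [lra|]; apply log2_le.
- pose proof (pow2_ge_0 (PX - sV * (1 + U))); unfold Rdiv; nra.
- rewrite Hsq; apply Rplus_le_compat_l, Rmult_le_compat_r; [lra|].
  apply pow_incr; nra.
Qed.

Lemma varrho_lim_0 (sW PX : R) :
  0 < sW -> 0 < PX ->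
  filterlim (fun sV : R => varrho (sW ^ 2) (PX ^ 2) sV)
    (at_right 0) (locally (1 / 2 * log2 (1 + PX ^ 2 / sW ^ 2))).
Proof.
intros HW HP.
assert (Hinv : 0 < / sW ^ 2) by (apply Rinv_0_lt_compat; nra).
set (U := sqrt (1 + PX ^ 2 / sW ^ 2)).
assert (HU : 1 <= U).
{ unfold U; rewrite <- sqrt_1 at 1; apply sqrt_le_1_alt; unfold Rdiv; nra. }
pose (g := fun sV => 1 + (PX - sV * (1 + U)) ^ 2 / sW ^ 2).
assert (Hg0 : g 0 = 1 + PX ^ 2 / sW ^ 2).
{ unfold g; now rewrite Rmult_0_l, Rminus_0_r. }
apply (filterlim_le_le (fun sV => 1 / 2 * log2 (g sV)) _
         (fun _ => 1 / 2 * log2 (1 + PX ^ 2 / sW ^ 2))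
         (Finite (1 / 2 * log2 (1 + PX ^ 2 / sW ^ 2)))).
(* This radius is exactly what the hypothesis of [varrho_ge] requires. *)
- assert (Hd : 0 < PX / (1 + U)) by (apply Rdiv_lt_0_compat; lra).
  exists (mkposreal _ Hd); intros y Hy Hy0; simpl in Hy.
  apply Rabs_def2 in Hy; unfold minus, plus, opp in Hy; simpl in Hy.
  assert (HyP : y * (1 + U) <= PX).
  { replace PX with (PX / (1 + U) * (1 + U)) by (field; lra).
    apply Rmult_le_compat_r; lra. }
  split; [now apply varrho_ge | apply varrho_le; nra].
(* The lower bound is continuous on both sides of [0], so its one-sided limit is its value there. *)
- eapply filterlim_filter_le_1; [apply filter_le_within|].
  rewrite <- Hg0; change (continuous (fun sV => 1 / 2 * log2 (g sV)) 0).
  apply (continuous_scal_r (1 / 2) (fun sV => log2 (g sV))).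
  apply (continuous_comp g log2).
  + apply (ex_derive_continuous g); unfold g; auto_derive; exact I.
  + apply continuous_log2; rewrite Hg0; unfold Rdiv; nra.
- apply filterlim_const.
Qed.

Lemma varrho_half (sW PX : R) :
  0 < sW -> 0 < PX -> varrho (sW ^ 2) (PX ^ 2) (PX / 2) = 0.
Proof.
intros HW HP.
destruct (varrho_log2 sW PX (PX / 2)) as [u [Hu [-> Heq]]]; try lra.
pose proof (sqrt_pos (u ^ 2 - 1)).
(* The right-hand side is [PX / 2 * (1 - u)], nonpositive for [1 <= u], while the left is
   nonnegative. *)
replace u with 1 by nra.
unfold log2; rewrite ln_1; unfold Rdiv; ring.
Qed.

Lemma varrho_sub_log2_le (sW PX sV : R) :
  0 < sW -> 0 < sV -> 2 * (sW + sV) <= PX ->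
  Rabs (varrho (sW ^ 2) (PX ^ 2) sV - log2 (PX / (sW + sV))) <= 1.
Proof.
intros HW HV HP.
destruct (varrho_log2 sW PX sV) as [u [Hu [-> Heq]]]; try lra.
set (x := PX / (sW + sV)).
assert (HPx : PX = x * (sW + sV)) by (unfold x; field; lra).
assert (Hx : 2 <= x) by nra.
assert (Hlow : u - 1 <= sqrt (u ^ 2 - 1)).
{ rewrite <- (sqrt_pow2 (u - 1)) by lra; apply sqrt_le_1_alt; nra. }
assert (Hup : sqrt (u ^ 2 - 1) <= u).
{ rewrite <- (sqrt_pow2 u) at 2 by lra; apply sqrt_le_1_alt; lra. }
(* The two root bounds give [x <= u + 1] and [u <= x + 1]; as [u] and [x] are at least [1], each is
   at most twice the other. *)
assert (x <= 2 * u) by nra.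
assert (u <= 2 * x) by nra.
assert (log2 x <= log2 (2 * u)) by (apply log2_le; lra).
assert (log2 u <= log2 (2 * x)) by (apply log2_le; lra).
rewrite log2_mult_2 in * by lra.
apply Rabs_le; lra.
Qed.

Lemma varrho_lim_infty (sW sV : R) :
  0 < sW -> 0 < sV ->
  is_lim (fun PX : R => varrho (sW ^ 2) (PX ^ 2) sV / log2 (PX / (sW + sV)))
    p_infty 1.
Proof.
intros HW HV; apply is_lim_spec; intros eps.
pose proof (cond_pos eps) as Heps.
(* The first bound allows [varrho_sub_log2_le]; the second makes the denominator exceed [/ eps], so
   an error of at most [1] divided by it is below [eps]. *)
exists (Rmax (2 * (sW + sV)) ((sW + sV) * Rpower 2 (/ eps))); intros PX HPX.
pose proof (Rmax_l (2 * (sW + sV)) ((sW + sV) * Rpower 2 (/ eps))).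
pose proof (Rmax_r (2 * (sW + sV)) ((sW + sV) * Rpower 2 (/ eps))).
pose proof (varrho_sub_log2_le sW PX sV HW HV ltac:(lra)) as Hclose.
assert (HL : / eps < log2 (PX / (sW + sV))).
{ rewrite <- (log2_Rpower (/ eps)); unfold log2, Rdiv.
  apply Rmult_lt_compat_r; [apply Rinv_0_lt_compat, ln_2_pos|].
  apply ln_increasing; [apply exp_pos|].
  apply Rmult_lt_reg_r with (sW + sV); [lra|].
  rewrite Rmult_assoc, Rinv_l; lra. }
assert (Hie : 0 < / eps) by now apply Rinv_0_lt_compat.
set (L := log2 (PX / (sW + sV))) in *.
replace (varrho (sW ^ 2) (PX ^ 2) sV / L - 1)
  with ((varrho (sW ^ 2) (PX ^ 2) sV - L) / L) by (field; lra).
rewrite Rabs_div, (Rabs_pos_eq L) by lra.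
apply Rmult_lt_reg_r with L; [lra|].
unfold Rdiv; rewrite Rmult_assoc, Rinv_l, Rmult_1_r by lra.
apply Rle_lt_trans with (1 := Hclose).
rewrite <- (Rinv_r eps) by lra; now apply Rmult_lt_compat_l.
Qed.

Theorem mainTheorem4 :
  (forall sW PX : R, 0 < sW -> 0 < PX ->
     filterlim (fun sV : R => varrho (sW ^ 2) (PX ^ 2) sV)
       (at_right 0) (locally (1 / 2 * log2 (1 + PX ^ 2 / sW ^ 2))))
  /\
  (forall sW PX : R, 0 < sW -> 0 < PX ->
     varrho (sW ^ 2) (PX ^ 2) (PX / 2) = 0)
  /\
  (forall sW sV : R, 0 < sW -> 0 < sV ->
     is_lim (fun PX : R => varrho (sW ^ 2) (PX ^ 2) sV / log2 (PX / (sW + sV)))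
       p_infty 1).
Proof.
split; [exact varrho_lim_0 | split; [exact varrho_half | exact varrho_lim_infty]].
Qed.
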